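(* For every $r>1$ there exist $N_0(r)\in\mathbb{N}$ and a constant $C_r>0$ (both depending only on $r$) such that the following holds. Let $(a_n)_{n\in\mathbb{N}}$ be an increasing sequence of positive integers which is lacunary with growth factor $r$, and let $N\ge N_0(r)$. Then there exists $\alpha\in\mathbb{R}$ (which may depend on $N$) such that $$G(\{\alpha a_n\}_{n\le N})\le C_r\,\frac{\log N}{N}.$$
   Context: A sequence $(a_n)_{n\in\mathbb{N}}$ is lacunary with growth factor $r>1$ if $a_{n+1}\ge r a_n$ for every $n\in\mathbb{N}$. Maximal gap: for a finite family of real numbers $z_1,\dots,z_m$ ($m\ge1$), reduce each $z_i$ modulo $1$ to a representative in $[0,1)$ and sort these representatives as $0\le y_1\le y_2\le\dots\le y_m<1$; put $y_{m+1}:=1+y_1$. Then $G(\{z_i\}_{i\le m}):=\max_{2\le k\le m+1}(y_k-y_{k-1})$ is the largest gap between neighbouring points on the unit torus. Thus $G(\{\alpha a_n\}_{n\le N})$ is the maximal gap of the points $\alpha a_1,\dots,\alpha a_N$ modulo $1$. *)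

(* Defs.v *)
From mathcomp Require Import all_boot all_order all_algebra.
From mathcomp Require Import all_classical all_reals all_analysis.

Set Implicit Arguments.
Unset Strict Implicit.
Unset Printing Implicit Defensive.

Import Order.TTheory GRing.Theory Num.Theory.
Local Open Scope ring_scope.

Definition lacunary (R : realType) (r : R) (a : nat -> R) : Prop :=
  forall n : nat, r * a n <= a n.+1.

Definition fract_part (R : realType) (x : R) : R := x - (Num.floor x)%:~R.

(* y_1 <= ... <= y_m followed by y_(m+1) = 1 + y_1 *)
Definition torus_points (R : realType) (z : seq R) : seq R :=
  let y := sort <=%R [seq fract_part x | x <- z] in rcons y (1 + head 0 y).

(* Only meant for z nonempty.  All gaps are nonnegative, so the default value
   0 of the maximum plays no role. *)
Definition max_gap (R : realType) (z : seq R) : R :=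
  let y := torus_points z in
  \big[Num.max/0]_(0 <= k < size z) (y`_k.+1 - y`_k).

(* Main.v *)
(* Thin out the sequence so that its ratios are at least 4, and fix an arc of
   length d. Cutting an interval K into cells of length 2 / A_0, each cell loses
   a proportion d / 2 to the multiples that hit the arc at A_0; iterating on the
   remaining pieces, the multiples missing the arc at A_0, ..., A_(n-1) have
   measure at most (1 - d/4)^n (|K| + d / A_0). With d = 1 / M and M of order
   N / ln N, the union over M consecutive arcs has measure less than 1, so some
   multiple hits all of them. *)
Require Import Defs.
From mathcomp Require Import all_boot all_order all_algebra.
From mathcomp Require Import all_classical all_reals all_analysis.
From mathcomp Require Import ring lra zify.

Set Implicit Arguments.
Unset Strict Implicit.
Unset Printing Implicit Defensive.

Import Order.TTheory GRing.Theory Num.Theory.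
Local Open Scope ring_scope.

(** * From density of lifted points to a bound on the maximal gap *)

(** Taking [x] to be a sorted point [y_k] yields a lift strictly beyond it, at distance at most
    [eta]; the next entry of the closed-up list comes no later than that lift. *)
Lemma max_gap_le (R : realType) (z : seq R) (eta : R) :
  0 <= eta ->
  (forall x, exists w (j : int), w \in z /\ x < w + j%:~R <= x + eta) ->
  max_gap z <= eta.
Proof.
move=> eta0 dense; rewrite /max_gap /torus_points.
set y := sort _ _.
have szy : size y = size z by rewrite size_sort size_map.
have y01 u : u \in y -> 0 <= u < 1.
  rewrite mem_sort => /mapP[w _ ->].
  by have := floor_itv w; rewrite /fract_part intrD; lra.
have ysorted : sorted <=%R y by exact: sort_le_sorted.
rewrite big_mkord; apply: bigmax_le => // -[k /= kz] _.
have [w [j [wz wj]]] := dense y`_k.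
have yk01 : 0 <= y`_k < 1 by apply: y01; rewrite mem_nth // szy.
have fy : fract_part w \in y by rewrite mem_sort map_f.
have f01 := y01 _ fy.
have wE : w + j%:~R = fract_part w + (Num.floor w + j)%:~R.
  by rewrite /fract_part intrD; ring.
move: wj; rewrite wE; set c := (Num.floor w + j)%R => wj.
rewrite !nth_rcons szy kz.
case/andP: wj => wj1 wj2.
suff le_next : (if (k.+1 < size z)%N then y`_k.+1
        else if k.+1 == size z then 1 + head 0 y else 0)
        <= fract_part w + c%:~R.
  by rewrite lerBlDl; exact: le_trans le_next wj2.
set i := index (fract_part w) y.
have iy : (i < size y)%N by rewrite index_mem.
have yi : y`_i = fract_part w by rewrite nth_index.
have le_nth a b : (a <= b)%N -> (b < size y)%N -> y`_a <= y`_b.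
  by move=> ab bn; apply: le_sorted_leq_nth => //; rewrite inE ?(leq_ltn_trans ab).
(* A lift with [c < 0] would lie below [0 <= y_k]; with [c >= 1] it is at or past [1 + y_0], the
   wrap-around endpoint; with [c = 0] it is [y_i], and strictness forces [k < i]. *)
case: (ltrgtP c 0) => c0.
- have : (c%:~R : R) <= -1 by rewrite (_ : -1 = (-1)%:~R) // ler_int; lia.
  by lra.
- have c1 : 1 <= (c%:~R : R) by rewrite (_ : 1 = 1%:~R) // ler_int; lia.
  case: ifP => k1.
    by have : y`_k.+1 < 1; [have := y01 y`_k.+1; rewrite mem_nth ?szy // => /(_ isT)/andP[] | lra].
  case: ifP => _; last by lra.
  rewrite -nth0; have : y`_0 <= y`_i by exact: le_nth.
  by lra.
- rewrite c0 mulr0z addr0 in wj1 wj2 *.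
  have ki : (k < i)%N.
    rewrite ltnNge; apply/negP => ik.
    by have : y`_i <= y`_k; [apply: le_nth; rewrite ?szy | lra].
  have k1 : (k.+1 < size z)%N by rewrite -szy (leq_ltn_trans ki).
  by rewrite k1 -yi; apply: le_nth.
Qed.

(** * Upper bounds on outer measure and their subadditivity *)

(* The outer measure of [S] is at most [l]; no measurability of [S] is needed. *)
Definition coverable (R : realType) (S : set R) (l : R) : Prop :=
  exists2 T : set R, measurable T &
    (S `<=` T)%classic /\ (lebesgue_measure T <= l%:E)%E.

Section coverable_theory.
Context (R : realType).
Implicit Types (S : set R) (x y l : R).

Lemma lebesgue_measure_segment x y : x <= y ->
  lebesgue_measure (`[x, y]%classic : set R) = (y - x)%:E.
Proof.
rewrite lebesgue_measure_itv /= lte_fin EFinB le_eqVlt => /predU1P[->|->//].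
by rewrite ltxx -EFinB subrr.
Qed.

Lemma coverable_segment S x y l :
  (S `<=` `[x, y])%classic -> x <= y -> y - x <= l -> coverable S l.
Proof.
move=> Sxy xy yxl; exists `[x, y]%classic; first exact: measurable_itv.
by split=> //; rewrite lebesgue_measure_segment // lee_fin.
Qed.

Lemma coverableU S S1 S2 l l1 l2 : (S `<=` S1 `|` S2)%classic ->
  coverable S1 l1 -> coverable S2 l2 -> l1 + l2 <= l -> coverable S l.
Proof.
move=> S12 [T1 mT1 [ST1 l1T1]] [T2 mT2 [ST2 l2T2]] ll.
exists (T1 `|` T2)%classic; first exact: measurableU.
split; first by move=> t /S12[/ST1|/ST2]; [left|right].
apply: (@le_trans _ _ (lebesgue_measure T1 + lebesgue_measure T2)%E).
  exact: measureU2.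
by apply: (le_trans (leeD l1T1 l2T2)); rewrite -EFinD lee_fin.
Qed.

Lemma coverable_bigcup (S : nat -> set R) l n :
  (forall i, (i < n)%N -> coverable (S i) l) ->
  coverable (\bigcup_(i in [set i | (i < n)%N]) S i) (n%:R * l).
Proof.
elim: n => [_|n IH Sl].
  by apply: (coverable_segment (x := 0) (y := 0)) => [t []| |]//; lra.
apply: (coverableU (S1 := \bigcup_(i in [set i | (i < n)%N]) S i) (S2 := S n)
  (l1 := n%:R * l) (l2 := l)).
- move=> t [i /=]; rewrite ltnS leq_eqVlt => /predU1P[->|lt_in] Sit; first by right.
  by left; exists i.
- by apply: IH => i lt_in; apply: Sl; rewrite ltnW.
- exact: Sl.
- by rewrite -natr1; lra.
Qed.

Lemma coverable_unit_segment l : coverable `[0, 1]%classic l -> 1 <= l.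
Proof.
move=> [T mT [sT lT]]; rewrite -lee_fin -(subr0 (1 : R)).
rewrite -(lebesgue_measure_segment ler01); apply: le_trans lT.
by apply: le_measure => //; rewrite inE //; exact: measurable_itv.
Qed.

End coverable_theory.

(** * Measure of the multiples that miss an arc *)

Definition in_arc (R : realType) (s d x : R) : Prop :=
  exists j : int, s + j%:~R <= x <= s + d + j%:~R.

Definition missing (R : realType) (A : nat -> R) (n : nat) (s d x y : R) : set R :=
  [set t | x <= t <= y /\ forall i, (i < n)%N -> ~ in_arc s d (t * A i)].

Section missing_measure.
Context (R : realType) (s d : R).
Hypotheses (d0 : 0 < d) (d1 : d <= 1).

(** On [[p, q]] the product [t * A 0] runs through one lift of the arc, so only the two sides
    survive, under the conditions from [A 1] on. *)
Lemma missing_cut (A : nat -> R) n x p q y :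
  0 < A 0%N ->
  (exists j : int, p * A 0%N = s + j%:~R /\ q * A 0%N = s + d + j%:~R) ->
  (missing A n.+1 s d x y `<=`
    missing (A \o succn) n s d x p `|` missing (A \o succn) n s d q y)%classic.
Proof.
move=> A0 [j [pE qE]] t [/andP[xt ty] miss].
have miss' i : (i < n)%N -> ~ in_arc s d (t * (A \o succn) i) by exact: (miss i.+1).
case: (leP t p) => [tp|pt]; first by left; split; rewrite ?xt.
case: (leP q t) => [qt|tq]; first by right; split; rewrite ?qt.
exfalso; apply: (miss 0%N) => //; exists j.
by rewrite -pE -qE !ler_wpM2r // ltW.
Qed.

Lemma missing_split (A : nat -> R) n x p y :
  (missing A n s d x y `<=` missing A n s d x p `|` missing A n s d p y)%classic.
Proof.
move=> t [/andP[xt ty] miss].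
by case: (leP t p) => [tp|/ltW pt]; [left|right]; split; rewrite // ?xt ?pt.
Qed.

Lemma missing_succ_sub (A : nat -> R) n x y :
  (missing A n.+1 s d x y `<=` missing (A \o succn) n s d x y)%classic.
Proof. by move=> t [xty miss]; split=> // i; exact: (miss i.+1). Qed.

(* A cell of length [2 / A 0] contains a full interval of length [d / A 0] on
   which [t * A 0] runs through the arc, whatever the position of the cell. *)
Lemma missing_cell (A : nat -> R) n (b rho x : R) :
  0 < A 0%N ->
  (forall u v, u <= v ->
     coverable (missing (A \o succn) n s d u v) (rho * (v - u + b))) ->
  coverable (missing A n.+1 s d x (x + 2 / A 0%N))
    (rho * ((2 - d) / A 0%N + 2 * b)).
Proof.
move=> A0 IH; have A0' : A 0%N != 0 by rewrite gt_eqF.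
set W := (A 0%N)^-1; have W0 : 0 < W by rewrite invr_gt0.
have WA : W * A 0%N = 1 by rewrite mulVf.
(* [s + j] is the first lift of the start of the arc at or after [x * A 0]. Hence [p <= x + W], and
   the removed interval, of length [d * W <= W], fits in the cell. *)
pose j := Num.ceil (x * A 0%N - s).
have /andP[jlt jge] := ceil_itv (x * A 0%N - s).
rewrite -/j intrB in jlt jge.
pose p := (s + j%:~R) * W; pose q := p + d * W.
have pA : p * A 0%N = s + j%:~R by rewrite /p -mulrA WA mulr1.
have xE : x = x * A 0%N * W by rewrite -mulrA mulfV ?mulr1.
have xp : x <= p by rewrite xE ler_pM2r //; lra.
have px : p <= x + W.
  by rewrite {1}xE -[X in _ + X]mul1r -mulrDl ler_pM2r //; lra.
have dW : d * W <= W by rewrite ler_piMl // ltW.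
apply: (coverableU (missing_cut (p := p) (q := q) A0 _) (IH _ _ xp) (IH _ _ _)).
- by exists j; split=> //; rewrite /q mulrDl pA -mulrA WA; ring.
- by rewrite /q; lra.
- by rewrite le_eqVlt; apply/orP; left; apply/eqP; rewrite /q; ring.
Qed.

Lemma missing_cells (A : nat -> R) n (b rho x : R) m :
  0 < A 0%N ->
  (forall u v, u <= v ->
     coverable (missing (A \o succn) n s d u v) (rho * (v - u + b))) ->
  coverable (missing A n.+1 s d x (x + m%:R * (2 / A 0%N)))
    (m%:R * (rho * ((2 - d) / A 0%N + 2 * b))).
Proof.
move=> A0 IH; elim: m => [|m IHm].
  by apply: (coverable_segment (x := x) (y := x)) => [t []| |]; rewrite ?mul0r ?addr0 //; lra.
have -> : x + m.+1%:R * (2 / A 0%N) = x + m%:R * (2 / A 0%N) + 2 / A 0%N.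
  by rewrite -natr1; ring.
apply: (coverableU (@missing_split _ _ _ _ _) IHm (missing_cell _ A0 IH)).
by rewrite -natr1; lra.
Qed.

(* The error [d / A 0] absorbs the pieces created by cutting: their number is at
   most proportional to [A 0], while the next error is [4] times smaller. *)
Lemma missing_coverable n (A : nat -> R) x y :
  (forall i, 0 < A i) -> (forall i, 4 * A i <= A i.+1) -> x <= y ->
  coverable (missing A n s d x y) ((1 - d / 4) ^+ n * (y - x + d / A 0%N)).
Proof.
elim: n A x y => [|n IH] A x y A0 A4 xy.
  apply: (coverable_segment (x := x) (y := y)) => // [t []//|].
  by rewrite expr0 mul1r lerDl divr_ge0 // ltW.
set rho := (1 - d / 4) ^+ n; set b := d / A 1%N.
have rho0 : 0 <= rho by apply: exprn_ge0; have := d1; lra.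
have IH' u v : u <= v ->
    coverable (missing (A \o succn) n s d u v) (rho * (v - u + b)).
  by move=> uv; apply: IH => // i /=.
have A00 := A0 0%N.
have b4 : 4 * b <= d / A 0%N.
  rewrite /b mulrCA ler_pM2l // ler_pdivrMr // mulrC ler_pdivlMr //.
have b0 : 0 <= b by rewrite divr_ge0 // ltW.
set W := (A 0%N)^-1 in b4 *; have W0 : 0 < W by rewrite invr_gt0.
(* [m] whole cells fit in [[x, y]]; the remainder [[p, y]] is shorter than a cell and is bounded by
   the conditions from [A 1] on alone. *)
pose m := Num.truncn ((y - x) / (2 * W)).
have W20 : 0 < 2 * W by lra.
have /andP[m1 m2] : m%:R <= (y - x) / (2 * W) < m.+1%:R.
  by apply: truncn_itv; rewrite divr_ge0 //; lra.
rewrite ler_pdivlMr // in m1; rewrite ltr_pdivrMr // -natr1 in m2.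
pose p := x + m%:R * (2 * W).
have py : p <= y by rewrite /p; lra.
apply: (coverableU (@missing_split A n.+1 x p y) (missing_cells x m A00 IH')
  (l2 := rho * (y - p + b))).
  have [T mT [sT lT]] := IH' _ _ py; exists T => //; split=> //.
  exact: subset_trans (@missing_succ_sub A n p y) sT.
(* The cells gain [m * d * W], and their errors [2 * m * b] cost at most half of it. The other half
   is at least [d * (y - x) / 4 - d * W / 2]. With [b <= d * W / 4], the remaining [3 / 4 * d * W]
   is at most [(1 - d / 4) * d * W] since [d <= 1]. *)
rewrite exprSr -/rho -!mulrA [m%:R * (rho * _)]mulrCA -mulrDr ler_wpM2l //.
have mb : m%:R * (4 * b) <= m%:R * (d * W) by rewrite ler_wpM2l.
have dm : d * (y - x - 2 * W) <= d * (m%:R * (2 * W)) by rewrite ler_pM2l //; lra.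
have dW : d * (d * W) <= 1 * (d * W) by rewrite ler_wpM2r // mulr_ge0 // ltW.
by rewrite -/W /p; lra.
Qed.

End missing_measure.

(** * A multiple whose points meet every short window *)

(** Each arc [[i / M, (i + 1) / M]] is missed on a part of [[0, 1]] of measure at most [2 * rho].
    The total is below 1, so some [alpha] hits all [M] arcs, and every window of length [2 / M]
    contains a translate of one of them. *)
Lemma exists_dense_multiple (R : realType) (A : nat -> R) (n M : nat) :
  (0 < M)%N -> 1 <= A 0%N -> (forall i, 4 * A i <= A i.+1) ->
  2 * M%:R * (1 - (4 * M%:R)^-1) ^+ n < 1 :> R ->
  exists alpha : R, forall x : R, exists (i : nat) (j : int),
    (i < n)%N /\ x < alpha * A i + j%:~R <= x + 2 / M%:R.
Proof.
move=> M0 A01 A4 small.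
have M1 : 1 <= M%:R :> R by rewrite ler1n.
have Mpos : 0 < M%:R :> R by lra.
pose d : R := M%:R^-1.
have d0 : 0 < d by rewrite invr_gt0.
have d1 : d <= 1 by rewrite invf_le1.
have MdE : M%:R * d = 1 by rewrite mulfV // gt_eqF.
have Age1 i : 1 <= A i by elim: i => // i IH; have := A4 i; lra.
pose rho : R := (1 - d / 4) ^+ n.
have rho0 : 0 <= rho by apply: exprn_ge0; lra.
have rhoE : rho = (1 - (4 * M%:R)^-1) ^+ n by rewrite /rho invfM mulrC.
have cov i : coverable (missing A n (i%:R * d) d 0 1) (rho * 2).
  have Apos k : 0 < A k by have := Age1 k; lra.
  have [T mT [sT lT]] := missing_coverable (i%:R * d) d0 d1 n Apos A4 (@ler01 R).
  exists T => //; split=> //; apply: le_trans lT _; rewrite lee_fin.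
  rewrite ler_wpM2l //.
  have : d / A 0%N <= 1 by rewrite ler_pdivrMr //; lra.
  by lra.
have [alpha hit] : exists alpha : R, forall i : nat, (i < M)%N ->
    exists2 k, (k < n)%N & in_arc (i%:R * d) d (alpha * A k).
  apply: contrapT => /forallNP none.
  have := coverable_bigcup (S := fun i => missing A n (i%:R * d) d 0 1)
    (n := M) (fun i _ => cov i).
  move=> [T mT [sT lT]].
  suff /coverable_unit_segment : coverable `[0, 1]%classic (M%:R * (rho * 2)).
    by rewrite rhoE; lra.
  exists T => //; split=> // t /= t01; apply: sT.
  have /existsNP[i /not_implyP[iM nohit]] := none t.
  exists i => //; split; first by move: t01; rewrite in_itv.
  by move=> k kn arc; apply: nohit; exists k.
exists alpha => x.
(* Floor plus one makes the grid point [c / M] strictly larger than [x]. Division of [c] by [M]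
   gives the index [i] of the arc starting there and its integer shift [q]. *)
pose c : int := (Num.floor (M%:R * x) + 1)%R.
have Mz : (M%:Z != 0)%R by rewrite -lt0n.
have := modz_ge0 c Mz; have := ltz_mod c Mz; have := divz_eq c M%:Z.
case: (c %% M)%Z => // i cE iM _; set q := (c %/ M)%Z in cE.
have {}iM : (i < M)%N by lia.
have [k kn [j /andP[arc1 arc2]]] := hit i iM.
exists k, (q - j); split=> //.
have cR : (c%:~R : R) = q%:~R * M%:R + i%:R by rewrite cE intrD intrM.
have cd : c%:~R * d = q%:~R + i%:R * d by rewrite cR mulrDl -mulrA MdE mulr1.
have := floor_itv (M%:R * x); rewrite -/c => /andP[c1 c2].
have xE : x = M%:R * x * d by rewrite mulrAC MdE mul1r.
have xc : x < c%:~R * d by rewrite {1}xE ltr_pM2r.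
have cx : c%:~R * d <= x + d.
  rewrite {1}xE -[X in _ + X]mul1r -mulrDl ler_pM2r //.
  by rewrite /c intrD; lra.
by rewrite intrB -/d; lra.
Qed.

(** * Choice of the thinning step and of the number of arcs *)

Lemma exists_expr_ge4 (R : realType) (r : R) : 1 < r ->
  exists2 k, (0 < k)%N & 4 <= r ^+ k.
Proof.
move=> r1; have lr0 := ln_gt0 r1.
(* [3 / ln r] suffices because [r ^+ k = expR (k * ln r) >= 1 + k * ln r]. *)
have := truncnS_gt (3 / ln r); set k := (Num.truncn _).+1.
rewrite ltr_pdivrMr // => lt3; exists k => //.
have {1}-> : r = expR (ln r) by rewrite lnK // posrE; lra.
rewrite -expRM_natl; apply: le_trans (expR_ge1Dx _).
by lra.
Qed.

Lemma ln_natr_le_sqrt (R : realType) (N : nat) : (0 < N)%N ->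
  ln (N%:R : R) <= 2 * Num.sqrt (N%:R : R).
Proof.
move=> N0; set t := Num.sqrt _.
have t0 : 0 < t by rewrite sqrtr_gt0 ltr0n.
have NE : N%:R = t * t :> R by rewrite -expr2 sqr_sqrtr // ler0n.
have := @le_ln1Dx R (t - 1); rewrite [1 + _]addrC subrK NE lnM ?posrE // => ln_t.
by have : ln t <= t - 1; [apply: ln_t; lra | lra].
Qed.

Lemma ln_natr_ge_half (R : realType) (N : nat) : (1 < N)%N ->
  2^-1 <= ln (N%:R : R).
Proof.
move=> N1; have N2 : 2 <= N%:R :> R by rewrite ler_nat.
have Npos : 0 < N%:R :> R by lra.
have inv_le : N%:R^-1 <= 2^-1 :> R by rewrite lef_pV2 ?posrE.
have inv_gt : 0 < N%:R^-1 :> R by rewrite invr_gt0.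
have := @le_ln1Dx R (N%:R^-1 - 1); rewrite [1 + _]addrC subrK lnV ?posrE // => ln_inv.
by have : - ln N%:R <= N%:R^-1 - 1 :> R; [apply: ln_inv; lra | lra].
Qed.

(** [M] is the integer part of [X = N / (9 * k * ln N)]. Then [2 * M <= N], while the power is at
    most [expR (- n / (4 * M))], which is below [1 / N]. The bound on [N] gives [36 * k <= sqrt N],
    whence [X >= 2]. *)
Lemma exists_arc_count (R : realType) (k N : nat) :
  (0 < k)%N -> ((36 * k) ^ 2 <= N)%N ->
  exists M : nat, [/\ (0 < M)%N,
    2 * M%:R * (1 - (4 * M%:R)^-1) ^+ (N %/ k) < 1 :> R &
    2 / M%:R <= 36 * k%:R * (ln N%:R / N%:R) :> R].
Proof.
move=> k0 kN.
have N1 : (1 < N)%N by nia.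
have k1 : 1 <= k%:R :> R by rewrite ler1n.
have Npos : 0 < N%:R :> R by rewrite ltr0n; lia.
set L := ln N%:R; set n := (N %/ k)%N.
have L2 : 2^-1 <= L by exact: ln_natr_ge_half.
have kL : 2^-1 <= k%:R * L by nra.
have LN : 18 * (k%:R * L) <= N%:R.
  have := @ln_natr_le_sqrt R N (ltnW N1); rewrite -/L; set t := Num.sqrt _ => Lt.
  have NE : N%:R = t * t :> R by rewrite -expr2 sqr_sqrtr // ler0n.
  have t0 : 0 <= t by exact: sqrtr_ge0.
  have kt : 36 * k%:R <= t.
    rewrite -(@ler_pXn2r R 2) ?nnegrE ?mulr_ge0 //.
    by rewrite [t ^+ 2]expr2 -NE -natrM -natrX ler_nat.
  have : k%:R * L <= k%:R * (2 * t) by rewrite ler_wpM2l //; lra.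
  have : 36 * k%:R * t <= t * t by rewrite ler_wpM2r.
  by rewrite NE; lra.
have D0 : 0 < 9 * (k%:R * L) by lra.
set X := N%:R / (9 * (k%:R * L)).
have XE : X * (9 * (k%:R * L)) = N%:R by rewrite /X mulfVK // gt_eqF.
have X2 : 2 <= X by rewrite ler_pdivlMr //; lra.
have /andP[M1 M2] : (Num.truncn X)%:R <= X < (Num.truncn X).+1%:R.
  by apply: truncn_itv; lra.
move: M1 M2; set M := Num.truncn X; rewrite -natr1 => M1 M2.
have Mpos : 0 < M%:R :> R by lra.
exists M; split; first by rewrite -(ltr0n R).
- have nk : N%:R < (n%:R + 1) * k%:R :> R.
    by rewrite natr1 -natrM ltr_nat -ltn_divLR.
  have MLk : M%:R * (9 * (k%:R * L)) <= N%:R by rewrite -XE ler_wpM2r // ltW.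
  (* The constant 9 leaves room for rounding in [N %/ k]: [4 * M * L * k <= 4 / 9 * N], whereas
     [n * k > N - k >= 35 / 36 * N]. *)
  have ML : 4 * M%:R * L < n%:R.
    rewrite -(@ltr_pM2r _ k%:R); last by lra.
    have : 36 * k%:R <= N%:R :> R.
      by rewrite -natrM ler_nat (leq_trans _ kN) // expnS expn1; nia.
    by nra.
  have MN : 2 * M%:R <= N%:R :> R.
    have : M%:R * 2 <= M%:R * (9 * (k%:R * L)) by rewrite ler_wpM2l //; lra.
    by lra.
  set e := (4 * M%:R)^-1.
  have e0 : 0 < e by rewrite invr_gt0; lra.
  have e1 : e <= 1 by rewrite invf_le1; lra.
  have pow_le : (1 - e) ^+ n <= expR (- (n%:R * e)).
    rewrite -mulrN expRM_natl lerXn2r ?nnegrE ?expR_ge0 //; first by lra.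
    exact: expR_ge1Dx.
  apply: (@le_lt_trans _ _ (N%:R * expR (- (n%:R * e)))).
    by rewrite ler_pM //; apply: exprn_ge0; lra.
  have -> : N%:R = expR L by rewrite lnK // posrE.
  rewrite -expRD expR_lt1 subr_lt0 ltr_pdivlMr; lra.
(* Since [X >= 2], truncation at most halves it: [M > X - 1 >= X / 2]. *)
- have -> : 36 * k%:R * (L / N%:R) = 4 / X.
    rewrite /X invf_div; field; lra.
  by rewrite ler_pdivrMr // mulrAC ler_pdivlMr; lra.
Qed.

Theorem theorem2p1 (R : realType) (r : R) (hr : 1 < r) :
  exists (N0 : nat) (C : R), (0 < N0)%N /\ 0 < C /\
    forall a : nat -> nat,
      (forall n : nat, (0 < a n)%N) ->
      increasing_seq a ->
      lacunary r (fun n : nat => (a n)%:R) ->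
      forall N : nat, (N0 <= N)%N ->
        exists alpha : R,
          max_gap (mkseq (fun n : nat => alpha * (a n)%:R) N)
            <= C * (ln N%:R / N%:R).
Proof.
have [k k0 rk] := exists_expr_ge4 hr.
exists ((36 * k) ^ 2)%N, (36 * k%:R); split; first by rewrite expn_gt0 muln_gt0 k0.
split; first by rewrite mulr_gt0 // ltr0n.
move=> a apos _ lac N NN0.
have [M [M0 small gapM]] := exists_arc_count R k0 NN0.
(* Keeping every [k]-th term raises the growth factor to [r ^+ k >= 4]. *)
pose A i : R := (a (k * i)%N)%:R.
have a_iter m l : r ^+ l * (a m)%:R <= (a (m + l)%N)%:R.
  elim: l => [|l IH]; first by rewrite mul1r addn0.
  rewrite exprS -mulrA addnS; apply: le_trans (lac _).
  by rewrite ler_pM2l //; lra.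
have A4 i : 4 * A i <= A i.+1.
  rewrite /A mulnS addnC; apply: le_trans (a_iter _ _).
  by rewrite ler_wpM2r.
have A01 : 1 <= A 0%N by rewrite ler1n.
have [alpha dense] := exists_dense_multiple M0 A01 A4 small.
exists alpha; apply: le_trans gapM.
apply: max_gap_le => [|x]; first by rewrite divr_ge0.
have [i [j [iN xj]]] := dense x.
exists (alpha * A i), j; split=> //.
apply: map_f; rewrite mem_iota add0n /=.
(* From [i < N %/ k] follows [k * i + k <= N], so the thinned index stays below [N]. *)
by move: iN; rewrite leq_divRL // mulSn mulnC; lia.
Qed.
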